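(* For any uncountable regular cardinal $\kappa$ there is a densely ordered chain $(X,<)$ without endpoints, of cardinality $\kappa$, which is epimorphism-rigid.
   Context: The axiom of choice is assumed (ZFC). A chain is a linearly ordered set. An epimorphism of a chain $X$ is a surjective map $f:X\to X$ with $x\le y\Rightarrow f(x)\le f(y)$. A chain is epimorphism-rigid if its only epimorphism is the identity map. *)

(* Defs.v *)
From mathcomp Require Import all_boot all_order.
From mathcomp Require Import boolp classical_sets functions cardinality wochoice.

Set Implicit Arguments.
Unset Strict Implicit.
Unset Printing Implicit Defensive.

Import Order.TTheory.
Local Open Scope classical_set_scope.
Local Open Scope card_scope.
Local Open Scope order_scope.

(* A cardinal is an initial ordinal: a well-ordered chain that is not
   equipotent to any of its proper initial segments.  Since such a segment is
   a subset, "not equipotent" is "the whole chain does not inject into it". *)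
Definition is_cardinal {d : Order.disp_t} (K : orderType d) : Prop :=
  well_order (<=%O : rel K) /\
  forall x : K, ~ ([set: K] #<= [set y : K | y < x]).

Definition cofinal {d : Order.disp_t} {K : orderType d} (A : set K) : Prop :=
  forall x : K, exists2 y : K, A y & x <= y.

(* Infinite and cf(K) = K, where cf(K) is the least cardinality of a cofinal
   subset. *)
Definition regular_cardinal {d : Order.disp_t} (K : orderType d) : Prop :=
  [/\ is_cardinal K,
      infinite_set [set: K] &
      forall A : set K, cofinal A -> [set: K] #<= A].

Definition uncountable_regular_cardinal {d : Order.disp_t} (K : orderType d)
    : Prop :=
  regular_cardinal K /\ ~ countable [set: K].

Definition densely_ordered {d : Order.disp_t} (X : orderType d) : Prop :=
  forall x y : X, x < y -> exists z : X, x < z /\ z < y.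

Definition without_endpoints {d : Order.disp_t} (X : orderType d) : Prop :=
  forall x : X, (exists y : X, y < x) /\ (exists z : X, x < z).

Definition chain_epimorphism {d : Order.disp_t} (X : orderType d)
    (f : X -> X) : Prop :=
  set_surj [set: X] [set: X] f /\ {homo f : x y / x <= y}.

Definition epimorphism_rigid {d : Order.disp_t} (X : orderType d) : Prop :=
  forall f : X -> X, chain_epimorphism f -> f = id.

(* Main.v *)
(* The chain consists of finite nonempty sequences over K, ordered
   lexicographically with each sequence lying above all its extensions, so that a
   point s with extensions is the limit of the K-sequence s.b (b in K).  Pick
   pairwise disjoint stationary sets T_s of limit points of K, one for each s, and
   forbid extending s.a when a is in T_s; this forces the supremum of the s.b with
   b < a to exist exactly when a is in T_s, for limit a.
   Let f be an epimorphism and choose y_b with f(y_b) = s.b.  The increasing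
   sequence y_b is bounded, hence has a supremum t, again a point with extensions,
   and on a club of a the sequences (y_b) and (t.b), b < a, define the same cut.
   Since f preserves suprema, T_t is contained in T_s modulo a club, so t = s and
   f(s) = s.  Points with extensions are dense, so f is the identity. *)

Require Import Defs.
From HB Require Import structures.
From mathcomp Require Import all_boot all_order.
From mathcomp Require Import boolp classical_sets functions cardinality wochoice.

Set Implicit Arguments.
Unset Strict Implicit.
Unset Printing Implicit Defensive.

Import Order.TTheory.
Local Open Scope classical_set_scope.
Local Open Scope card_scope.
Local Open Scope order_scope.

(** * Stationary sets on a regular cardinal *)

Lemma injective_card_le (U V : Type) (g : U -> V) :
  injective g -> [set: U] #<= [set: V].
Proof.
move=> injg; have [h] : $|{injfun [set: U] >-> [set: V]}|.
  by apply/injfunPex; exists g => // u v _ _; apply: injg.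
exact: inj_card_le h.
Qed.

Section Stationary.
Context {dk : Order.disp_t} {K : orderType dk}.

Definition closed_under (g : K -> K) (a : K) : Prop := forall b, b < a -> g b < a.

(* The closure points of functions generate the club filter, so this is
   stationarity in the usual sense for sets not containing the least element. *)
Definition stationary (S : set K) : Prop :=
  forall g : K -> K, exists2 a, S a & closed_under g a.

(** The strict inequalities exclude the least element and successors, so [a] is a limit of
    cofinality omega. *)
Definition ladder (a : K) (c : nat -> K) : Prop :=
  (forall n, c n < a) /\ forall b, b < a -> exists n, b < c n.

Definition cof_omega (a : K) : Prop := exists c, ladder a c.

Hypothesis hK : uncountable_regular_cardinal K.

Lemma exists_min (A : set K) : A !=set0 -> exists2 m, A m & forall x, A x -> m <= x.
Proof.
move=> [x Ax]; have [[[wo _] _ _] _] := hK.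
have [|m [[mA lbm] _]] := wo (fun y => `[< A y >]); first by exists x; apply/asboolP.
exists m => [|y Ay]; first exact/asboolP.
by apply: lbm; apply/asboolP.
Qed.

Lemma card_le_injection (A : set K) :
  [set: K] #<= A -> exists f : K -> K, injective f /\ forall w, A (f w).
Proof.
move=> /card_leP[f].
pose setT_in (x : K) : set_type [set: K] := SigSub (mem_set (I : [set: K] x)).
exists (fun w => val (f (setT_in w))); split=> [x y /val_inj|w]; last exact: set_valP.
have injf : injective f by move=> u v; apply: inj; rewrite inE.
by move=> /injf /(congr1 val).
Qed.

Lemma not_cofinal_bounded (A : set K) :
  ~ ([set: K] #<= A) -> exists b, forall x, A x -> x < b.
Proof.
have [[_ _ reg] _] := hK.
move=> nA; apply: contrapT => nb; apply/nA/reg => x.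
apply: contrapT => nx; apply: nb; exists x => y Ay.
by rewrite ltNge; apply/negP => xy; apply: nx; exists y.
Qed.

Lemma no_max (x : K) : exists y, x < y.
Proof.
have [|y yP] := @not_cofinal_bounded [set x]; last by exists y; apply: yP.
have [[_ infK _] _] := hK.
by move=> /card_le_finite /(_ (finite_set1 x)).
Qed.

Lemma bounded_on_segment (h : K -> K) (m : K) : exists b, forall v, v <= m -> h v < b.
Proof.
have [|b bP] := @not_cofinal_bounded (h @` [set v | v <= m]); last first.
  by exists b => v vm; apply: bP; exists v.
have [[[_ seg] _ _] _] := hK; have [m' mm'] := no_max m.
move=> le; apply: (seg m'); apply: card_le_trans le _.
apply: card_le_trans (card_image_le _ _) _; apply: subset_card_le => v /= vm.
exact: le_lt_trans mm'.
Qed.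

Lemma bounded_sequence (h : nat -> K) : exists b, forall n, h n < b.
Proof.
have [|b bP] := @not_cofinal_bounded (range h); last first.
  by exists b => n; apply: bP; exists n.
have [_ ncK] := hK; move=> le; apply: ncK; apply: card_le_trans le _.
exact: card_image_le.
Qed.

Lemma exists_succ (a : K) : exists2 b, a < b & forall c, a < c -> b <= c.
Proof. by apply: exists_min; have [b ab] := no_max a; exists b. Qed.

(** Otherwise each value stops occurring at some point, and a common bound of these countably many
    points has no value left. *)
Lemma pigeonhole_nat (h : K -> nat) : exists n, forall b, exists2 c, b <= c & h c = n.
Proof.
apply: contrapT => nP.
have /choice[w wP] : forall n, exists b, forall c, b <= c -> h c <> n.
  move=> n; apply: contrapT => nb; apply: nP; exists n => b.
  apply: contrapT => nc; apply: nb; exists b => c bc hc.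
  by apply: nc; exists c.
have [b bP] := bounded_sequence w.
by apply: (wP (h b) b) => //; apply/ltW.
Qed.

Lemma pigeonhole_segment (h : K -> K) (d m : K) :
  (forall c, d <= c -> h c <= m) -> exists v, forall b, exists2 c, b <= c & h c = v.
Proof.
move=> hm; apply: contrapT => nP.
have /choice[w wP] : forall v, exists b, forall c, b <= c -> h c <> v.
  move=> v; apply: contrapT => nb; apply: nP; exists v => b.
  apply: contrapT => nc; apply: nb; exists b => c bc hc.
  by apply: nc; exists c.
have [b bP] := bounded_on_segment w m.
have dle : d <= Order.max b d by rewrite le_max lexx orbT.
apply: (wP (h (Order.max b d)) (Order.max b d)) => //.
by rewrite le_max (ltW (bP _ _)) ?hm.
Qed.

Lemma cof_omega_dense (a b : K) : cof_omega a -> b < a -> exists2 c, b < c & c < a.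
Proof. by move=> [c [ca cof]] /cof[n bn]; exists (c n). Qed.

(** The immediate successor of [b]. Such letters will lie in no [T u] and so produce inner nodes. *)
Lemma exists_not_cof_omega (b : K) :
  exists2 c, b < c & ~ cof_omega c /\ forall a, cof_omega a -> b < a -> c < a.
Proof.
have [c bc cmin] := exists_succ b; exists c => //.
have noc : ~ cof_omega c.
  by move=> /cof_omega_dense /(_ bc)[e be]; rewrite ltNge cmin.
split=> // a oa ba; rewrite lt_neqAle cmin // andbT.
by apply/eqP => ca; apply: noc; rewrite ca.
Qed.

Lemma stationary_cof_omega : stationary [set a | cof_omega a].
Proof.
move=> g.
have /choice[nxt nxtP] : forall b, exists b', b < b' /\ forall v, v <= b -> g v < b'.
  move=> b; have [b1 b1P] := bounded_on_segment g b.
  have [b2 b2P] := no_max (Order.max b b1); exists b2; move: b2P.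
  by rewrite gt_max => /andP[-> b12]; split=> // v /b1P /lt_trans; apply.
have [[[_ _] infK _] _] := hK.
have [x0 _] : [set: K] !=set0 by apply: infinite_setN0.
pose c n := iter n nxt x0.
have [a ac amin] : exists2 a, (forall n, c n < a) &
    forall b, (forall n, c n < b) -> a <= b.
  by apply: exists_min; have [b bP] := bounded_sequence c; exists b.
(* [a] is the supremum of the iterates of [nxt], so each [b < a] is passed by some [c n], and then
   [g b < c n.+1]. *)
have cof b : b < a -> exists n, b < c n.
  move=> ba; apply: contrapT => nb.
  have /amin : forall n, c n < b.
    move=> n; apply: (@lt_le_trans _ _ (c n.+1)); first by case: (nxtP (c n)).
    by rewrite leNgt; apply/negP => bc; apply: nb; exists n.+1.
  by rewrite leNgt ba.
exists a; first by exists c.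
move=> b /cof[n bn]; apply: lt_trans (ac n.+1).
by have [_] := nxtP (c n); apply; apply/ltW.
Qed.

(** Diagonal intersection: if [G v] witnesses failure for [v] and [g b] bounds all [G v w] with
    [v, w <= b], a closure point [a] of [g] is one of [G (r a)]. *)
Lemma fodor (S : set K) (r : K -> K) :
  stationary S -> (forall a, S a -> r a < a) ->
  exists v, stationary [set a | S a /\ r a = v].
Proof.
move=> statS reg; apply: contrapT => nP.
have /choice[G GP] : forall v, exists g : K -> K,
    forall a, S a -> r a = v -> ~ closed_under g a.
  move=> v; apply: contrapT => ng; apply: nP; exists v => g.
  apply: contrapT => na; apply: ng; exists g => a Sa ra cl.
  by apply: na; exists a.
have /choice[g gP] : forall b, exists b', forall v w, v <= b -> w <= b -> G v w < b'.
  move=> b.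
  have /choice[h hP] : forall v, exists b', forall w, w <= b -> G v w < b'.
    by move=> v; apply: bounded_on_segment.
  have [b' b'P] := bounded_on_segment h b.
  by exists b' => v w /b'P hv /hP Gv; apply: lt_trans hv.
have [a Sa cl] := statS g; apply: (GP (r a) a Sa) => // b ba.
have mlt : Order.max (r a) b < a by rewrite gt_max reg.
by apply: lt_trans (cl _ mlt); apply: gP; rewrite le_max lexx ?orbT.
Qed.

(* Fix a ladder at each point of cofinality omega.  Some [n] is such that the
   [n]-th rung exceeds any given bound stationarily often; otherwise all rungs
   would have a common bound on a club.  By Fodor the fibres of the [n]-th rung
   are then stationary for cofinally, hence [K]-many, values. *)
Lemma stationary_partition : exists T : K -> set K,
  [/\ forall v, stationary (T v),
      forall v a, T v a -> cof_omega a &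
      forall v w a, T v a -> T w a -> v = w].
Proof.
have [[_ infK reg] _] := hK.
have [x0 _] : [set: K] !=set0 by apply: infinite_setN0.
have /choice[c cP] : forall a : K, exists c : nat -> K, cof_omega a -> ladder a c.
  move=> a; have [[c ca]|na] := pselect (cof_omega a); first by exists c.
  by exists (fun=> x0).
have [n nP] : exists n, forall x, stationary [set a | cof_omega a /\ x <= c a n].
  apply: contrapT => nP.
  have /choice[xg xgP] : forall n, exists xg : K * (K -> K),
      forall a, cof_omega a -> xg.1 <= c a n -> ~ closed_under xg.2 a.
    move=> n; apply: contrapT => nx; apply: nP; exists n => x g.
    apply: contrapT => na; apply: nx; exists (x, g) => a oa xa cl.
    by apply: na; exists a.
  have [x xP] := bounded_sequence (fun n => (xg n).1).
  have /choice[g gP] : forall b, exists b', x < b' /\ forall n, (xg n).2 b < b'.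
    move=> b; have [b1 b1P] := bounded_sequence (fun n => (xg n).2 b).
    have [b2 b2P] := no_max (Order.max x b1); exists b2; move: b2P.
    by rewrite gt_max => /andP[-> b12]; split=> // m; apply: lt_trans b12.
  have [a oa cl] := stationary_cof_omega g.
  have [ca cof] := cP _ oa.
  have xa : x < a by apply: lt_trans (cl _ (ca 0)); have [] := gP (c a 0).
  have [m xm] := cof _ xa.
  apply: (xgP m a oa); first exact/ltW/(lt_trans (xP m)).
  by move=> b /cl; apply: lt_trans; have [_] := gP b.
pose T v := [set a | cof_omega a /\ c a n = v].
have cofT : cofinal [set v | stationary (T v)].
  move=> x; have [|v statv] := @fodor _ (fun a => c a n) (nP x).
    by move=> a [/cP[ca _] _].
  exists v => /=.
    by move=> g; have [a [[oa _] cv] cl] := statv g; exists a.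
  by have [a [[_ xa] <-]] := statv id.
have [f [injf statf]] := card_le_injection (reg _ cofT).
by exists (fun v => T (f v)); split=> [v|v a []|v w a [_ av] [_ aw]] //;
  [apply: statf | apply: injf; rewrite -av -aw].
Qed.

Lemma stationary_cofinal (S : set K) :
  stationary S -> (forall a, S a -> cof_omega a) -> cofinal S.
Proof.
move=> statS So x; have [a Sa cl] := statS (fun=> x); exists a => //.
by have [c [ca _]] := So _ Sa; apply/ltW/(cl (c 0)).
Qed.

(* Mapping [(v, w)] to the [w]-th element of [T v], for disjoint stationary sets
   [T v], is a pairing function on [K]. *)
Lemma inj_seq : exists code : seq K -> K, injective code.
Proof.
have [T [statT oT disjT]] := stationary_partition.
have [[_ infK reg] _] := hK.
have [x0 _ x0min] : exists2 x, [set: K] x & forall y, [set: K] y -> x <= y.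
  by apply: exists_min; apply: infinite_setN0.
have /choice[p pP] : forall v, exists f : K -> K, injective f /\ forall w, T v (f w).
  by move=> v; apply/card_le_injection/reg/stationary_cofinal => //; apply: oT.
pose code := foldr p x0.
(* Values of [p] have ladders, so the least element [x0] is free to code the empty sequence. *)
have codeN x u : code (x :: u) <> x0.
  move=> /= eq0; have [_ /(_ (code u))/oT[c [/(_ 0)]]] := pP x.
  by rewrite eq0 ltNge x0min.
exists code; elim=> [|x u IH] [|y v] //=.
- by move=> /esym /codeN.
- by move=> /codeN.
move=> eqp.
have [[_ xP] [_ yP]] := (pP x, pP y).
have Ty : T y (p x (code u)) by rewrite eqp.
have xy := disjT _ _ _ (xP _) Ty.
rewrite xy in eqp *; have [injp _] := pP y.
by rewrite (IH _ (injp _ _ eqp)).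
Qed.

End Stationary.
(** * The lexicographic order on finite sequences *)

Section LexSeq.
Context {dk : Order.disp_t} {K : orderType dk}.
Implicit Types s t u v w : seq K.

(* Lexicographic, with the end of a sequence as the largest letter: [s] is the
   maximum of the cone of its extensions. *)
Fixpoint lex_le s t : bool :=
  match s, t with
  | _, [::] => true
  | [::], _ :: _ => false
  | x :: s', y :: t' => (x < y) || (x == y) && lex_le s' t'
  end.

Fact lex_le_refl : reflexive lex_le.
Proof. by elim=> //= x s ->; rewrite eqxx orbT. Qed.

Fact lex_le_anti : antisymmetric lex_le.
Proof.
elim=> [|x s IH] [|y t] //= /andP[/orP[xy|/andP[/eqP <- st]]].
  by rewrite (gt_eqF xy) ltNge ltW.
by rewrite ltxx eqxx /= => ts; rewrite (IH t) // st.
Qed.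

Fact lex_le_trans : transitive lex_le.
Proof.
move=> t s; elim: s t => [|x s IH] [|y t] [|z u] //=.
case/orP=> [xy|/andP[/eqP-> st]]; case/orP=> [yz|/andP[/eqP<- tu]].
- by rewrite (lt_trans xy yz).
- by rewrite xy.
- by rewrite yz.
- by rewrite eqxx (IH _ _ st tu) orbT.
Qed.

Fact lex_le_total : total lex_le.
Proof.
elim=> [|x s IH] [|y t] //=; case: (ltgtP x y) => /= [||_] //; apply: IH.
Qed.

HB.instance Definition _ :=
  Order.Le_isPOrder.Build dk (seq K) lex_le_refl lex_le_anti lex_le_trans.

HB.instance Definition _ := Order.POrder_isTotal.Build dk (seq K) lex_le_total.

Lemma le_cons x y s t : (x :: s <= y :: t) = (x < y) || (x == y) && (s <= t).
Proof. by []. Qed.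

Lemma cons_lt x y s t : x < y -> x :: s < y :: t.
Proof. by move=> xy; rewrite ltNge le_cons negb_or -leNgt ltW // gt_eqF. Qed.

Lemma le_nil s : s <= [::].
Proof. by case: s. Qed.

Lemma le_cat2l u s t : (u ++ s <= u ++ t) = (s <= t).
Proof. by elim: u => //= x u; rewrite le_cons ltxx eqxx. Qed.

Lemma lt_cat2l u s t : (u ++ s < u ++ t) = (s < t).
Proof. by rewrite !ltNge le_cat2l. Qed.

Lemma lt_catr u x v : u ++ x :: v < u.
Proof. by rewrite -{2}[u]cats0 lt_cat2l ltNge. Qed.

Lemma le_rcons u x v y : (u ++ x :: v <= rcons u y) = (x <= y).
Proof. by rewrite -cats1 le_cat2l le_cons le_nil andbT orbC -le_eqVlt. Qed.

(** Either [s] properly extends [t], or the first difference is a smaller letter of [s], which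
    extending [t] does not affect. *)
Lemma lt_cone s t : s < t ->
  (exists x v, s = t ++ x :: v) \/ forall v, s < t ++ v.
Proof.
elim: t s => [|y t IH] [|x s].
- by rewrite ltxx.
- by move=> _; left; exists x, s.
- by rewrite ltNge le_nil.
rewrite ltNge le_cons negb_or -leNgt negb_and -ltNge.
rewrite le_eqVlt eq_sym; case: (eqVneq x y) => [-> /=|_ /=]; last first.
  by rewrite andbT => xy; right=> v; apply: cons_lt.
move=> /IH[[z [v ->]]|st]; first by left; exists z, v.
by right=> v; rewrite /= -cat1s -(cat1s _ (t ++ v)) lt_cat2l.
Qed.

End LexSeq.

(** * The rigid chain *)

Section Tree.
Context {dk : Order.disp_t} {K : orderType dk}.
Variable T : seq K -> set K.
Implicit Types (s t u v w : seq K) (a b c : K).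

(* A node [rcons u a] has proper extensions among the nodes unless [T u a]; so for
   limit [a] it is the supremum of the [rcons u b] with [b < a] iff [T u a]. *)
Definition inner u : Prop := forall w a v, u = w ++ a :: v -> ~ T w a.

Definition node s : Prop := exists u a, s = rcons u a /\ inner u.

Definition tree : Type := {s : seq K | `[< node s >]}.

HB.instance Definition _ := SubChoice.on tree.
HB.instance Definition _ := [SubChoice_isSubOrder of tree by <: with dk].

Lemma inner_nil : inner [::].
Proof. by case. Qed.

Lemma inner_cat u v : inner (u ++ v) -> inner u.
Proof. by move=> inn w a z uE; apply: (inn w a (z ++ v)); rewrite uE -catA. Qed.

Lemma inner_rcons u a : inner u -> ~ T u a -> inner (rcons u a).
Proof.
move=> innu nT w b v; case/lastP: v => [|v c].
  by rewrite cats1 => /rcons_inj[<- <-].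
by rewrite -rcons_cons -rcons_cat => /rcons_inj[uE _]; apply: innu uE.
Qed.

Lemma not_inner_leaf u a : T u a -> ~ inner (rcons u a).
Proof. by move=> Tua /(_ u a [::]); rewrite cats1 => /(_ erefl). Qed.

Lemma node_cat u a v : node (u ++ a :: v) -> inner u.
Proof.
move=> [w [b [+ innw]]]; case/lastP: v => [|v c].
  by rewrite cats1 => /rcons_inj[-> _].
rewrite -rcons_cons -rcons_cat => /rcons_inj[wE _].
by apply: (@inner_cat _ (a :: v)); rewrite wE.
Qed.

Lemma node_rcons u a : inner u -> node (rcons u a).
Proof. by exists u, a. Qed.

Lemma lt_rcons u a b : (rcons u a < rcons u b) = (a < b).
Proof. by rewrite !ltNge -[rcons u b]cats1 le_rcons. Qed.

Lemma rcons_lt u a : rcons u a < u.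
Proof. by rewrite -cats1 lt_catr. Qed.

Lemma le_below s t : s < t -> exists a, s <= rcons t a.
Proof.
move=> st; case: (lt_cone st) => [[a [v ->]]|lts].
  by exists a; rewrite le_rcons.
(* Any letter works here; the first letter of [s] supplies one. *)
case: s st lts => [|a s] st lts; first by rewrite ltNge le_nil in st.
by exists a; rewrite -cats1 ltW.
Qed.

Hypothesis hK : uncountable_regular_cardinal K.
Hypothesis limT : forall u a, T u a -> cof_omega a.

(** A leaf is the limit of its smaller siblings: [w] cannot extend it, so [w] continues [u] with a
    letter below [a] or lies under the whole cone of [u]. *)
Lemma le_leaf w u a : T u a -> node w -> w < rcons u a ->
  exists2 b, b < a & w <= rcons u b.
Proof.
move=> Tua nw wua; case: (lt_cone wua) => [[x [v wE]]|ltw].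
  by case: (not_inner_leaf Tua); rewrite wE in nw; apply: node_cat nw.
case: (lt_cone (lt_trans wua (rcons_lt u a))) => [[x [v wE]]|ltu].
  exists x; last by rewrite wE le_rcons.
  rewrite lt_neqAle -(le_rcons u x v a) -wE (ltW wua) andbT.
  apply/eqP => xa; have := ltw v; rewrite cat_rcons -xa -wE.
  by rewrite ltxx.
have [c [ca _]] := limT Tua.
by exists (c 0) => //; rewrite -cats1 ltW.
Qed.

Lemma inner_dense s t : node s -> node t -> s < t ->
  exists d, [/\ node d, inner d, s < d & d < t].
Proof.
move=> ns [u [a [tE innu]]] st; rewrite tE in st *.
have [Tua|nT] := pselect (T u a).
  have [b ba sb] := le_leaf Tua ns st.
  have [c bc [noc /(_ _ (limT Tua) ba) ca]] := exists_not_cof_omega hK b.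
  exists (rcons u c); rewrite lt_rcons ca; split=> //; first exact: node_rcons.
    by apply: inner_rcons => // /limT.
  by apply: le_lt_trans sb _; rewrite lt_rcons.
have innt := inner_rcons innu nT.
have [b sb] := le_below st.
have [c bc [noc _]] := exists_not_cof_omega hK b.
exists (rcons (rcons u a) c); rewrite rcons_lt; split=> //; first exact: node_rcons.
  by apply: inner_rcons => // /limT.
by apply: le_lt_trans sb _; rewrite lt_rcons.
Qed.

(** An inner node has children below it; any other node is [rcons w b] with [T w b], and its last
    letter, a limit lying in [v], can be lowered. *)
Lemma cone_no_min u v : inner u -> node (u ++ v) ->
  exists2 z, node (u ++ z) & u ++ z < u ++ v.
Proof.
move=> innu nuv; have [w [b [uvE innw]]] := nuv.
have [innuv|] := pselect (inner (u ++ v)).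
  by exists (rcons v b); rewrite -rcons_cat; [apply: node_rcons | apply: rcons_lt].
case/lastP: v uvE {nuv} => [|v c]; first by rewrite cats0.
rewrite -rcons_cat => /rcons_inj[uvE cE] ninn; rewrite uvE cE in ninn *.
have [/limT[l [lb _]]|nT] := pselect (T w b); last first.
  by case: ninn; apply: inner_rcons.
exists (rcons v (l 0)); rewrite -rcons_cat uvE ?lt_rcons //; exact: node_rcons.
Qed.

(* The supremum is the longest sequence that all [y b] eventually extend properly;
   it exists because [size (y b)] takes one value for cofinally many [b], and
   the next letters of the [y b] are then unbounded in [K]. *)
Lemma supremum_inner (y : K -> seq K) (p : seq K) :
  (forall b, node (y b)) -> {homo y : b c / b < c} ->
  (forall b, y b < p) -> p <> [::] ->
  exists t, [/\ node t, inner t, forall b, y b < t &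
                forall s, s < t -> exists b, s <= y b].
Proof.
move=> ny ymono yp pN.
have yle : {homo y : b c / b <= c} by apply: ltW_homo.
pose captured u := exists d, forall b, d <= b -> exists x v, y b = u ++ x :: v.
have [n nP] := pigeonhole_nat hK (size \o y).
(* If every captured sequence could be lengthened, one would have length [n]; but arbitrarily late
   [y b] have length [n] and cannot extend it properly. *)
have [u [d dP] noext] : exists2 u, captured u & forall x, ~ captured (rcons u x).
  apply: contrapT => next.
  have : exists2 u, captured u & size u = n.
    elim: {nP} n => [|n [u cu <-]].
      have [[_ infK _] _] := hK; have [x0 _] := infinite_setN0 infK.
      exists [::] => //; exists x0 => b _; have [w [x [-> _]]] := ny b.
      by case: w => [|z w]; [exists x, [::] | exists z, (rcons w x)].
    have [x cx] : exists x, captured (rcons u x).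
      by apply: contrapT => nx; apply: next; exists u => // x cx; apply: nx; exists x.
    by exists (rcons u x); rewrite ?size_rcons.
  move=> [u [d dP] sz]; have [b db /=] := nP d.
  have [x [v ->]] := dP _ db.
  by rewrite size_cat sz /= addnS => /eqP; rewrite gtn_eqF // ltnS leq_addr.
have /choice[i iP] : forall b, exists x, d <= b -> exists v, y b = u ++ x :: v.
  move=> b; have [[x [v yE]]|nyE] := pselect (exists x v, y b = u ++ x :: v).
    by exists x => _; exists v.
  by exists b => /dP.
have imono b c : d <= b -> b <= c -> i b <= i c.
  move=> db bc; have [v yb] := iP b db; have [w yc] := iP c (le_trans db bc).
  move: (yle _ _ bc); rewrite yb yc le_cat2l le_cons.
  by case/orP => [/ltW//|/andP[/eqP-> _]].
(* A bounded monotone [i] would be eventually constant, which makes [rcons u x] captured for that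
   constant [x]. *)
have iunb m : exists2 b, d <= b & m < i b.
  apply: contrapT => ni.
  have [|x xP] := @pigeonhole_segment _ _ hK i d m.
    by move=> c dc; rewrite leNgt; apply/negP => mc; apply: ni; exists c.
  have [e de ie] := xP d.
  have tail b : e <= b -> i b = x.
    move=> eb; apply/eqP; rewrite eq_le -{2}ie imono // andbT.
    by have [c bc <-] := xP b; apply: imono => //; apply: le_trans eb.
  apply: (noext x); have [e' ee'] := no_max hK e.
  exists e => b eb; have [v yb] := iP b (le_trans de eb).
  case: v yb => [|z v] yb; last by exists z, v; rewrite yb tail // cat_rcons.
  (* Here [y b] would be [rcons u x], the top of its cone, which a later [y c] in the same cone
     cannot exceed. *)
  have [c bc] := no_max hK b; have [v yc] := iP c (le_trans de (le_trans eb (ltW bc))).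
  have := ymono _ _ bc; rewrite yb yc !tail //; last exact: le_trans (ltW bc).
  by rewrite lt_cat2l ltNge le_cons ltxx eqxx le_nil.
have innu : inner u by have [x [v yd]] := dP d (lexx d); apply: (@node_cat u x v); rewrite -yd.
have uN : u <> [::].
  (* Otherwise the first letters of the [y b] would pass the first letter of [p]. *)
  move=> uE; case: p pN yp => // m p _ yp; have [b db mi] := iunb m.
  have [v yb] := iP b db; have := yp b; rewrite yb uE ltNge le_cons.
  by rewrite mi.
exists u; split=> //.
- case/lastP: u {noext dP iP uN} innu uN => // u a innu _.
  by exists u, a; split=> //; move: innu; rewrite -cats1; apply: inner_cat.
- move=> b; have dle : d <= Order.max b d by rewrite le_max lexx orbT.
  have ble : b <= Order.max b d by rewrite le_max lexx.
  have [x [v yE]] := dP _ dle; apply: le_lt_trans (yle _ _ ble) _.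
  by rewrite yE lt_catr.
- move=> s su; have [m sm] := le_below su.
  have [b db mi] := iunb m; have [v yb] := iP b db.
  by exists b; apply: le_trans sm _; rewrite yb -cats1 le_cat2l le_cons mi.
Qed.

Hypothesis statT : forall u, stationary (T u).
Hypothesis disjT : forall u w a, T u a -> T w a -> u = w.

(** * Epimorphisms fix the inner nodes *)

Section Epimorphism.
Variable f : tree -> tree.
Hypothesis epif : chain_epimorphism f.

Lemma tree_elt s : node s -> exists x : tree, val x = s.
Proof. by move=> /asboolP ns; exists (Sub s ns). Qed.

Lemma nodeP (x : tree) : node (val x).
Proof. exact/asboolP/(valP x). Qed.

Lemma epi_homo (x y : tree) : x <= y -> f x <= f y.
Proof. by have [_] := epif; apply. Qed.

Lemma epi_lt (x y : tree) : f x < f y -> x < y.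
Proof. by rewrite !ltNge; apply: contra => /epi_homo. Qed.

Lemma epi_surj s : node s -> exists x, val (f x) = s.
Proof.
move=> /tree_elt[z <-]; have [surjf _] := epif.
by have [x _ <-] := surjf z I; exists x.
Qed.

Lemma epi_fix_inner (s : tree) : inner (val s) -> f s = s.
Proof.
move=> inns.
have /choice[y yP] : forall b, exists x, val (f x) = rcons (val s) b.
  by move=> b; apply/epi_surj/node_rcons.
have [p fp] := epi_surj (nodeP s); move/val_inj in fp.
have [] := @supremum_inner (val \o y) (val p).
- by move=> b; apply: nodeP.
- by move=> b c bc; apply: epi_lt; rewrite -lt_val !yP lt_rcons.
- by move=> b; apply: epi_lt; rewrite fp -lt_val yP rcons_lt.
- by have [u [a [-> _]]] := nodeP p; case: u.
move=> t0 [/tree_elt[t <-] innt yt ycof] {t0}.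
have fcof (x : tree) : x < t -> exists b, val (f x) <= rcons (val s) b.
  move=> /ycof[b xb]; exists b; rewrite -yP Order.le_val; exact: epi_homo.
suff ts : t = s.
  (* [p < s] would put [f p] below [s], so [s <= p] and [f s <= s]; and [f s < s] would put some
     [y c] above [s]. *)
  rewrite ts in yt fcof; apply/eqP; rewrite eq_le; apply/andP; split.
    rewrite -[X in _ <= X]fp; apply: epi_homo; rewrite leNgt; apply/negP.
    by move=> /fcof[b]; rewrite fp leNgt rcons_lt.
  rewrite leNgt; apply/negP; rewrite -lt_val => /le_below[b fsb].
  have [c bc] := no_max hK b.
  have : s < y c.
    by apply: epi_lt; rewrite -lt_val yP; apply: le_lt_trans fsb _; rewrite lt_rcons.
  by rewrite ltNge -Order.le_val ltW // yt.
apply: contrapT => nts.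
have /choice[g1 g1P] : forall b, exists c, val (y b) <= rcons (val t) c.
  by move=> b; apply/le_below/yt.
have /choice[l lP] : forall b, exists x : tree, val x = rcons (val t) b.
  by move=> b; apply/tree_elt/node_rcons.
have lt_l b : l b < t by rewrite -lt_val lP rcons_lt.
have /choice[g2 g2P] : forall b, exists c, val (f (l b)) <= rcons (val s) c.
  by move=> b; apply/fcof.
(* Closure under [g1] makes [f (l a)] an upper bound of the [rcons s b] with [b < a]; closure under
   [g2] keeps the [f (l b)] with [b < a] below [rcons s a]. *)
have [a Ta cl] := statT (val t) (fun b => Order.max (g1 b) (g2 b)).
have cl1 b : b < a -> g1 b < a by move=> /cl; rewrite gt_max => /andP[].
have cl2 b : b < a -> g2 b < a by move=> /cl; rewrite gt_max => /andP[].
have ge_fl b : b < a -> rcons (val s) b <= val (f (l a)).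
  move=> ba; rewrite -yP Order.le_val; apply: epi_homo; rewrite -Order.le_val lP.
  by apply: le_trans (g1P b) _; rewrite ltW // lt_rcons cl1.
have [c0 [c0a _]] := limT Ta.
have fls : val (f (l a)) < val s by apply: le_lt_trans (g2P a) (rcons_lt _ _).
(* Disjointness excludes [T s a], so [rcons s a] is inner and its cone has no least node: some node
   of it lies below [f (l a)]. *)
have [z' nz zlt] : exists2 z', node (val s ++ a :: z') &
    val s ++ a :: z' < val (f (l a)).
  have [[x [v flE]]|fl_lt] := lt_cone fls; last first.
    by have := ge_fl _ (c0a 0); rewrite leNgt -cats1 fl_lt.
  have ax : a <= x.
    rewrite leNgt; apply/negP => /(cof_omega_dense (limT Ta))[b xb ba].
    by have := ge_fl b ba; rewrite flE leNgt -cats1 lt_cat2l cons_lt.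
  move: ax flE; rewrite le_eqVlt => /orP[/eqP<-|ax] flE; last first.
    exists [::]; first by rewrite cats1; apply: node_rcons.
    by rewrite flE lt_cat2l cons_lt.
  have innsa : inner (rcons (val s) a).
    by apply: inner_rcons => // /disjT /(_ Ta) /val_inj /esym.
  have [|z nz zlt] := @cone_no_min (rcons (val s) a) v innsa.
    by rewrite cat_rcons -flE; apply: nodeP.
  by exists z; move: nz zlt; rewrite !cat_rcons -flE.
(* A preimage of that node is below the leaf [l a], hence at or below some [l b] with [b < a], which
   forces its image below the cone of [rcons s a]. *)
have [w fw] := epi_surj nz.
have wl : w < l a by apply: epi_lt; rewrite -lt_val fw.
have [b ba wb] : exists2 b, b < a & val w <= rcons (val t) b.
  by apply: le_leaf Ta (nodeP w) _; rewrite -lP lt_val.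
have : val (f w) <= rcons (val s) (g2 b).
  by apply: le_trans (g2P b); rewrite Order.le_val epi_homo // -Order.le_val lP.
by rewrite fw le_rcons leNgt cl2.
Qed.

End Epimorphism.

(** If [f] moved [x], a fixed inner node strictly between [x] and [f x] would contradict
    monotonicity. *)
Lemma tree_rigid : epimorphism_rigid tree.
Proof.
move=> f epif; apply/funext => x /=.
have fixd := epi_fix_inner epif.
apply/eqP; rewrite eq_le !leNgt; apply/andP; split; apply/negP; rewrite -lt_val.
  move=> /(inner_dense (nodeP _) (nodeP _))[_ [/tree_elt[d <-] innd xd df]].
  move: df; rewrite -(fixd d innd) lt_val => /(epi_lt epif).
  by rewrite ltNge -Order.le_val ltW.
move=> /(inner_dense (nodeP _) (nodeP _))[_ [/tree_elt[d <-] innd fd dx]].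
move: fd; rewrite -(fixd d innd) lt_val => /(epi_lt epif).
by rewrite ltNge -Order.le_val ltW.
Qed.

Lemma tree_dense : densely_ordered tree.
Proof.
move=> x y; rewrite -lt_val => /(inner_dense (nodeP _) (nodeP _)).
by move=> [_ [/tree_elt[d <-] _ xd dy]]; exists d.
Qed.

Lemma tree_without_endpoints : without_endpoints tree.
Proof.
move=> x; split.
  have [z nz zx] := @cone_no_min [::] (val x) inner_nil (nodeP x).
  by have [y yE] := tree_elt nz; exists y; rewrite -lt_val yE.
have [c [s xE]] : exists c s, val x = c :: s.
  by have [[|c u] [a [-> _]]] := nodeP x; do 2 eexists.
have [e ce] := no_max hK c.
have [y yE] := tree_elt (node_rcons e inner_nil).
by exists y; rewrite -lt_val yE xE cons_lt.
Qed.

Lemma tree_card : [set: tree] #= [set: K].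
Proof.
have [code injcode] := inj_seq hK.
have /choice[l lP] : forall a, exists x : tree, val x = [:: a].
  by move=> a; apply/tree_elt/(node_rcons a inner_nil).
rewrite card_eq_le; apply/andP; split.
  by apply: (@injective_card_le _ _ (code \o val)) => x y /injcode/val_inj.
apply: (@injective_card_le _ _ l) => a b /(congr1 val).
by rewrite !lP => -[].
Qed.

End Tree.

Theorem theorem5p1 (dk : Order.disp_t) (K : orderType dk)
    (hK : uncountable_regular_cardinal K) :
  exists (d : Order.disp_t) (X : orderType d),
    [/\ densely_ordered X,
        without_endpoints X,
        [set: X] #= [set: K] &
        epimorphism_rigid X].
Proof.
have [code injcode] := inj_seq hK.
have [T [statT oT disjT]] := stationary_partition hK.
(* The injective coding reindexes the disjoint stationary sets by sequences. *)
pose Tc u := T (code u).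
have limTc u a : Tc u a -> cof_omega a by apply: oT.
have statTc u : stationary (Tc u) by apply: statT.
have disjTc u w a : Tc u a -> Tc w a -> u = w.
  by move=> Tu Tw; apply/injcode/disjT; [apply: Tu | apply: Tw].
exists dk, (tree Tc); split.
- exact: tree_dense hK limTc.
- exact: tree_without_endpoints hK limTc.
- exact: tree_card hK.
- exact: tree_rigid hK limTc statTc disjTc.
Qed.
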